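(* For each $b>(\pi/2)^{1/2}$ there exists a smooth function $\phi\in C^\infty(\mathbb R)$ satisfying $$\frac{d^2\phi}{dy^2}=8\pi(1-e^{\phi}),\qquad \phi(y+b)=\phi(y)\ \text{for all } y\in\mathbb R,$$ and attaining its maximum value at $y=0$, such that, writing $\beta=\pi^{1/2}b$, $$\frac1{2b}\int_0^b\phi(1+e^\phi)\,dy+\frac{\beta^2}{3}-\log(4\beta^2)+1-4\sum_{n=1}^\infty\log\big|1-e^{-2n\beta^2}\big|\ <\ 0.$$ *)

(* Defs.v *)
From Stdlib Require Import Reals.
From Coquelicot Require Import Coquelicot.
Open Scope R_scope.

Definition smooth (f : R -> R) : Prop :=
  forall (n : nat) (x : R), ex_derive_n f n x.

(* Main.v *)
Require Import Defs.
From Stdlib Require Import Reals Lra Psatz.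
From Coquelicot Require Import Coquelicot.
Open Scope R_scope.

(** After rescaling, the equation is [u'' = 1 - exp u], with conserved energy
    [E = u'^2 / 2 + (exp u - u - 1)].  Let [J(E)] be half the area enclosed by the
    orbit of energy [E] in the phase plane.  Then [J'(E)] is the half period, and on an
    orbit of half period [tau] the integral of [u (1 + exp u) / 2] over a half period is
    [J(E) - tau E].  Choosing the orbit by minimizing [J(E) - tau E] over [E] therefore
    gives at once an orbit of the required period and, through any trial energy, an
    upper bound for its integral.  With top value [ln A] for the trial orbit, the speed is
    [sqrt 2 * sqrt (A + t - A exp t)] where [t = u - ln A], and
    [sqrt (A + t - A exp t) <= sqrt (A + t) - sqrt A (1 - sqrt (1 - exp t))]
    has an elementary primitive, which bounds [J] sharply enough. *)

(** * Monotonicity from derivatives and differentiable inverses on the line *)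

Lemma is_derive_continuity_pt (f : R -> R) (x l : R) :
  is_derive f x l -> continuity_pt f x.
Proof.
  intros H. apply derivable_continuous_pt. exists l. now apply is_derive_Reals.
Qed.

Lemma mean_value (f f' : R -> R) (x y : R) :
  (forall z, is_derive f z (f' z)) ->
  exists c, Rmin x y <= c <= Rmax x y /\ f y - f x = f' c * (y - x).
Proof.
  intros H. apply MVT_gen; intros z _; [apply H|].
  exact (is_derive_continuity_pt _ _ _ (H z)).
Qed.

Lemma derive_zero_constant (f : R -> R) (x y : R) :
  (forall z, is_derive f z 0) -> f x = f y.
Proof.
  intros H. destruct (mean_value f (fun _ => 0) x y H) as [c [_ Hc]]. lra.
Qed.

Lemma derive_nonneg_increasing (f f' : R -> R) (x y : R) :
  (forall z, is_derive f z (f' z)) -> (forall z, 0 <= f' z) ->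
  x <= y -> f x <= f y.
Proof.
  intros H P L. destruct (mean_value f f' x y H) as [c [_ Hc]].
  specialize (P c). nra.
Qed.

Lemma derive_pos_increasing (f f' : R -> R) (x y : R) :
  (forall z, is_derive f z (f' z)) -> (forall z, 0 < f' z) ->
  x < y -> f x < f y.
Proof.
  intros H P L. destruct (mean_value f f' x y H) as [c [_ Hc]].
  specialize (P c). nra.
Qed.

(** The result is a sigma type so that the inverse can be named by projection. The brackets [lo] and
    [hi] supply surjectivity through the intermediate value theorem, and strict monotonicity
    supplies injectivity. *)
Lemma increasing_inverse (f f' lo hi : R -> R) :
  (forall x, is_derive f x (f' x)) -> (forall x, 0 < f' x) ->
  (forall y, f (lo y) <= y <= f (hi y)) ->
  {g : R -> R | (forall y, f (g y) = y) /\ (forall x, g (f x) = x) /\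
                (forall y, is_derive g y (/ f' (g y)))}.
Proof.
  intros Hf Hp Hlh.
  assert (Hinc : forall x y, x < y -> f x < f y)
    by (intros; now apply derive_pos_increasing with f').
  assert (Hc : continuity f)
    by (intros x; exact (is_derive_continuity_pt _ _ _ (Hf x))).
  assert (Hs : forall y, {x : R | f x = y}).
  { intros y. destruct (IVT_gen f (lo y) (hi y) y Hc) as [x [_ Hx]].
    - destruct (Hlh y). split.
      + apply Rle_trans with (f (lo y)); [apply Rmin_l|lra].
      + apply Rle_trans with (f (hi y)); [lra|apply Rmax_r].
    - now exists x. }
  set (g := fun y => proj1_sig (Hs y)).
  assert (Hfg : forall y, f (g y) = y)
    by (intros y; unfold g; now destruct (Hs y)).
  assert (Hinj : forall x y, f x = f y -> x = y).
  { intros x y E. destruct (Rtotal_order x y) as [L|[L|L]]; auto;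
    apply Hinc in L; lra. }
  assert (Hgf : forall x, g (f x) = x) by (intros x; apply Hinj, Hfg).
  assert (Hlt : forall x y, f x < f y -> x < y).
  { intros x y L. destruct (Rlt_le_dec x y) as [|[L'|L']]; auto.
    - apply Hinc in L'. lra.
    - subst. lra. }
  exists g. split; [exact Hfg|split; [exact Hgf|]].
  intros y. apply is_derive_Reals. intros eps Heps.
  set (x := g y).
  assert (Hx : f x = y) by apply Hfg.
  (* The difference quotient of the inverse is the reciprocal of that of [f], so its limit is the
     reciprocal of the nonzero limit [f' x]. *)
  assert (Hq : exists d, 0 < d /\ forall k, k <> 0 -> Rabs k < d ->
      Rabs (k / (f (x + k) - f x) - / f' x) < eps).
  { assert (Hl : is_lim (fun k => (f (x + k) - f x) / k) 0 (f' x)).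
    { apply is_lim_spec. intros e.
      destruct (proj1 (is_derive_Reals _ _ _) (Hf x) e (cond_pos e)) as [d Hd].
      exists d. intros k Hk Hk0. apply Hd; auto.
      replace k with (k - 0) by ring. exact Hk. }
    apply is_lim_inv in Hl; [|intros E; injection E; specialize (Hp x); lra].
    apply is_lim_spec in Hl. destruct (Hl (mkposreal _ Heps)) as [d Hd].
    exists d. split; [apply cond_pos|]. intros k Hk0 Hk.
    replace (k / (f (x + k) - f x)) with (/ ((f (x + k) - f x) / k)).
    - apply Hd; auto. change (Rabs (k - 0) < d). now rewrite Rminus_0_r.
    - rewrite Rinv_div. reflexivity. }
  destruct Hq as [d [Hd Hq]].
  assert (H1 : f (x - d) < y) by (rewrite <- Hx; apply Hinc; lra).
  assert (H2 : y < f (x + d)) by (rewrite <- Hx; apply Hinc; lra).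
  (* With this radius, [y + t] lies strictly between [f (x - d)] and [f (x + d)], so monotonicity
     forces the increment [k] of the inverse into [(-d, d)]. *)
  assert (Hm : 0 < Rmin (y - f (x - d)) (f (x + d) - y)) by (apply Rmin_pos; lra).
  exists (mkposreal _ Hm). simpl. intros t Ht0 Ht.
  set (k := g (y + t) - x).
  assert (Ek : f (x + k) = y + t)
    by (unfold k; replace (x + (g (y + t) - x)) with (g (y + t)) by ring; apply Hfg).
  assert (A1 := Rmin_l (y - f (x - d)) (f (x + d) - y)).
  assert (A2 := Rmin_r (y - f (x - d)) (f (x + d) - y)).
  apply Rabs_def2 in Ht.
  change (Rabs (k / t - / f' x) < eps).
  replace t with (f (x + k) - f x) by lra.
  apply Hq.
  - intros E. rewrite E, Rplus_0_r, Hx in Ek. lra.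
  - apply Rabs_def1.
    + assert (x + k < x + d) by (apply Hlt; rewrite Ek; lra). lra.
    + assert (x - d < x + k) by (apply Hlt; rewrite Ek; lra). lra.
Qed.

(** * The potential, its regularized quotients and the radial coordinate *)

Definition potential (u : R) : R := exp u - u - 1.

(** Dividing out the double zero of the potential leaves a positive continuous factor. The signed
    square root is then [u] times the root of that factor, with no case split on the sign of [u]. *)
Definition potential_ratio (u : R) : R :=
  if Req_dec_T u 0 then 1 else 2 * potential u / u ^ 2.

Definition force_ratio (u : R) : R :=
  if Req_dec_T u 0 then 1 else (exp u - 1) / u.

Lemma potential_ratio_mul (u : R) : u ^ 2 * potential_ratio u = 2 * potential u.
Proof.
  unfold potential_ratio, potential. destruct (Req_dec_T u 0) as [->|N].
  - rewrite exp_0. ring.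
  - field. exact N.
Qed.

Lemma force_ratio_mul (u : R) : u * force_ratio u = exp u - 1.
Proof.
  unfold force_ratio. destruct (Req_dec_T u 0) as [->|N].
  - rewrite exp_0. ring.
  - field. exact N.
Qed.

(** Both differences are nondecreasing on the whole line and vanish at the origin, so each changes
    sign there. Monotonicity reduces to [1 + x <= exp x], taken at [u] for the first and at [- u]
    for the second. *)
Lemma potential_bounds (u : R) :
  (0 <= u -> u ^ 2 <= 2 * potential u <= u ^ 2 * exp u) /\
  (u <= 0 -> u ^ 2 * exp u <= 2 * potential u <= u ^ 2).
Proof.
  unfold potential.
  set (f1 := fun u => 2 * (exp u - u - 1) - u ^ 2).
  set (f2 := fun u => u ^ 2 * exp u - 2 * (exp u - u - 1)).
  assert (M1 : forall x y, x <= y -> f1 x <= f1 y).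
  { intros x y. apply derive_nonneg_increasing with (fun u => 2 * (exp u - 1 - u)).
    - intros z. unfold f1. auto_derive; [easy|ring].
    - intros z. pose proof (exp_ineq1_le z). lra. }
  assert (M2 : forall x y, x <= y -> f2 x <= f2 y).
  { intros x y. apply derive_nonneg_increasing with
      (fun u => exp u * (2 * exp (- u) + u ^ 2 + 2 * u - 2)).
    - intros z. unfold f2. auto_derive; [easy|].
      transitivity (2 * (exp z * exp (- z)) + exp z * (z ^ 2 + 2 * z - 2)); [|ring].
      rewrite <- exp_plus, Rplus_opp_r, exp_0. ring.
    - intros z. pose proof (exp_ineq1_le (- z)). pose proof (exp_pos z). nra. }
  assert (E1 : f1 0 = 0) by (unfold f1; rewrite exp_0; ring).
  assert (E2 : f2 0 = 0) by (unfold f2; rewrite exp_0; ring).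
  split; intros L; pose proof (M1 _ _ L); pose proof (M2 _ _ L);
    unfold f1, f2 in *; lra.
Qed.

Lemma force_bounds (u : R) :
  (0 <= u -> u <= exp u - 1 <= u * exp u) /\
  (u <= 0 -> u <= exp u - 1 <= u * exp u).
Proof.
  pose proof (exp_ineq1_le u). pose proof (exp_ineq1_le (- u)).
  assert (E : exp u * exp (- u) = 1)
    by (rewrite <- exp_plus, Rplus_opp_r; apply exp_0).
  pose proof (exp_pos u). split; intros L; nra.
Qed.

Lemma potential_ratio_bounds (u : R) :
  Rmin 1 (exp u) <= potential_ratio u <= Rmax 1 (exp u).
Proof.
  unfold potential_ratio. destruct (Req_dec_T u 0) as [->|N].
  { rewrite exp_0, Rmin_left, Rmax_left by lra. lra. }
  assert (P : 0 < u ^ 2) by nra.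
  destruct (potential_bounds u) as [B1 B2].
  destruct (Rle_lt_dec 0 u) as [L|L].
  - assert (1 <= exp u) by (pose proof (exp_ineq1_le u); lra).
    rewrite Rmin_left, Rmax_right by lra. specialize (B1 L).
    split; [apply Rle_div_r|apply Rle_div_l]; lra.
  - assert (exp u < 1) by (rewrite <- exp_0; now apply exp_increasing).
    rewrite Rmin_right, Rmax_left by lra. specialize (B2 (Rlt_le _ _ L)).
    split; [apply Rle_div_r|apply Rle_div_l]; lra.
Qed.

Lemma force_ratio_bounds (u : R) :
  Rmin 1 (exp u) <= force_ratio u <= Rmax 1 (exp u).
Proof.
  destruct (force_bounds u) as [B1 B2]. pose proof (force_ratio_mul u) as E.
  destruct (Req_dec_T u 0) as [->|N].
  { unfold force_ratio. destruct (Req_dec_T 0 0); [|lra].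
    rewrite exp_0, Rmin_left, Rmax_left by lra. lra. }
  destruct (Rle_lt_dec 0 u) as [L|L].
  - assert (1 <= exp u) by (pose proof (exp_ineq1_le u); lra).
    rewrite Rmin_left, Rmax_right by lra. specialize (B1 L). split; nra.
  - assert (exp u < 1) by (rewrite <- exp_0; now apply exp_increasing).
    rewrite Rmin_right, Rmax_left by lra. specialize (B2 (Rlt_le _ _ L)). split; nra.
Qed.

(** This settles the removable singularity of both quotients at once: the two bounds meet at the
    value 1. *)
Lemma squeeze_exp_continuous (f : R -> R) :
  (forall u, Rmin 1 (exp u) <= f u <= Rmax 1 (exp u)) -> continuity_pt f 0.
Proof.
  intros B.
  assert (F0 : f 0 = 1).
  { specialize (B 0). rewrite exp_0, Rmin_left, Rmax_left in B by lra. lra. }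
  intros eps Heps.
  destruct (is_derive_continuity_pt exp 0 1 ltac:(auto_derive; [easy|rewrite exp_0; ring])
              eps Heps) as [d [Hd H]].
  exists d. split; [exact Hd|]. intros x Hx. specialize (H x Hx).
  simpl in *. unfold R_dist in *. rewrite F0. rewrite exp_0 in H.
  specialize (B x). apply Rabs_def2 in H. apply Rabs_def1;
  revert B; unfold Rmin, Rmax; destruct (Rle_dec 1 (exp x)); lra.
Qed.

Lemma locally_nonzero (u : R) : u <> 0 -> locally u (fun t : R => t <> 0).
Proof.
  intros N. assert (P : 0 < Rabs u) by now apply Rabs_pos_lt.
  exists (mkposreal _ P). intros t Ht E. subst t.
  change (Rabs (0 - u) < Rabs u) in Ht.
  rewrite Rminus_0_l, Rabs_Ropp in Ht. lra.
Qed.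

Lemma potential_ratio_is_derive (u : R) : u <> 0 ->
  is_derive potential_ratio u (2 * (force_ratio u - potential_ratio u) / u).
Proof.
  intros N. apply is_derive_ext_loc with (fun u => 2 * potential u / u ^ 2).
  { apply filter_imp with (2 := locally_nonzero u N). intros t Ht.
    unfold potential_ratio. now destruct (Req_dec_T t 0). }
  unfold potential_ratio, force_ratio, potential.
  destruct (Req_dec_T u 0) as [?|_]; [easy|].
  auto_derive; [exact (pow_nonzero u 2 N)|]. field. exact N.
Qed.

Lemma potential_ratio_continuous (u : R) : continuity_pt potential_ratio u.
Proof.
  destruct (Req_dec_T u 0) as [->|N].
  - apply squeeze_exp_continuous, potential_ratio_bounds.
  - exact (is_derive_continuity_pt _ _ _ (potential_ratio_is_derive u N)).
Qed.

Lemma force_ratio_continuous (u : R) : continuity_pt force_ratio u.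
Proof.
  destruct (Req_dec_T u 0) as [->|N].
  - apply squeeze_exp_continuous, force_ratio_bounds.
  - apply is_derive_continuity_pt with ((exp u * u - (exp u - 1)) / u ^ 2).
    apply is_derive_ext_loc with (fun u => (exp u - 1) / u).
    { apply filter_imp with (2 := locally_nonzero u N). intros t Ht.
      unfold force_ratio. now destruct (Req_dec_T t 0). }
    auto_derive; [exact N|]. field. exact N.
Qed.

Lemma potential_ratio_pos (u : R) : 0 < potential_ratio u.
Proof.
  apply Rlt_le_trans with (2 := proj1 (potential_ratio_bounds u)).
  apply Rmin_pos; [lra|apply exp_pos].
Qed.

Lemma force_ratio_pos (u : R) : 0 < force_ratio u.
Proof.
  apply Rlt_le_trans with (2 := proj1 (force_ratio_bounds u)).
  apply Rmin_pos; [lra|apply exp_pos].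
Qed.

(* The signed square root of [2 * potential u]; it is a C^1 coordinate in which
   the energy levels [v^2 / 2 + potential u = const] become circles. *)
Definition radial (u : R) : R := u * sqrt (potential_ratio u).

Definition radial_deriv (u : R) : R := force_ratio u / sqrt (potential_ratio u).

Lemma radial_deriv_pos (u : R) : 0 < radial_deriv u.
Proof.
  apply Rdiv_lt_0_compat; [apply force_ratio_pos|].
  apply sqrt_lt_R0, potential_ratio_pos.
Qed.

Lemma radial_sqr (u : R) : radial u ^ 2 = 2 * potential u.
Proof.
  unfold radial. rewrite Rpow_mult_distr, pow2_sqrt.
  - apply potential_ratio_mul.
  - apply Rlt_le, potential_ratio_pos.
Qed.

Lemma sqrt_potential_ratio_continuous (u : R) :
  continuity_pt (fun u => sqrt (potential_ratio u)) u.
Proof.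
  apply (continuity_pt_comp potential_ratio sqrt).
  - apply potential_ratio_continuous.
  - apply continuity_pt_sqrt, Rlt_le, potential_ratio_pos.
Qed.

Lemma radial_deriv_continuous (u : R) : continuity_pt radial_deriv u.
Proof.
  apply (continuity_pt_div force_ratio (fun u => sqrt (potential_ratio u))).
  - apply force_ratio_continuous.
  - apply sqrt_potential_ratio_continuous.
  - apply Rgt_not_eq, sqrt_lt_R0, potential_ratio_pos.
Qed.

Lemma radial_is_derive (u : R) : is_derive radial u (radial_deriv u).
Proof.
  assert (Hs := sqrt_lt_R0 _ (potential_ratio_pos u)).
  destruct (Req_dec_T u 0) as [->|N].
  (* At the origin the difference quotient of [radial] is [sqrt (potential_ratio h)] itself, so
     continuity of that factor is already differentiability. *)
  - assert (V : radial_deriv 0 = 1).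
    { unfold radial_deriv, force_ratio, potential_ratio.
      destruct (Req_dec_T 0 0); [|lra]. rewrite sqrt_1. field. }
    rewrite V. apply is_derive_Reals. intros eps Heps.
    destruct (sqrt_potential_ratio_continuous 0 eps Heps) as [d [Hd H]].
    exists (mkposreal _ Hd). simpl. intros h Hh0 Hh.
    unfold radial. rewrite Rplus_0_l, Rmult_0_l, Rminus_0_r.
    replace (h * sqrt (potential_ratio h) / h) with (sqrt (potential_ratio h))
      by (field; exact Hh0).
    assert (S1 : sqrt (potential_ratio 0) = 1).
    { unfold potential_ratio. destruct (Req_dec_T 0 0); [apply sqrt_1|lra]. }
    simpl in H. unfold R_dist in H. rewrite S1 in H. apply H. split.
    + split; [exact I|]. auto.
    + now rewrite Rminus_0_r.
  - unfold radial, radial_deriv.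
    pose proof (potential_ratio_is_derive u N) as D.
    auto_derive.
    + split; [eexists; exact D|]. split; [apply potential_ratio_pos|easy].
    + rewrite (is_derive_unique (fun x : R => potential_ratio x) u _ D).
      apply Rmult_eq_reg_r with (sqrt (potential_ratio u)); [|lra].
      field_simplify; [|lra|split; lra].
      rewrite pow2_sqrt by (apply Rlt_le, potential_ratio_pos). field.
Qed.

(** On the left, [u = - (y ^ 2 / 2 + 1)] gives [radial u ^ 2 = y ^ 2 + 2 * exp u], with [radial u]
    negative. On the right, the ratio is at least 1 for nonnegative arguments. *)
Lemma radial_surjective (y : R) :
  radial (- (y ^ 2 / 2 + 1)) <= y <= radial (Rabs y).
Proof.
  split.
  - set (u := - (y ^ 2 / 2 + 1)).
    pose proof (radial_sqr u) as E. unfold potential in E.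
    pose proof (exp_pos u).
    assert (radial u < 0).
    { unfold radial. pose proof (sqrt_lt_R0 _ (potential_ratio_pos u)).
      assert (u < 0) by (unfold u; nra). nra. }
    assert (y ^ 2 <= radial u ^ 2) by (unfold u in *; lra). nra.
  - apply Rle_trans with (Rabs y); [apply Rle_abs|].
    pose proof (Rabs_pos y) as P. unfold radial.
    pose proof (potential_ratio_bounds (Rabs y)) as [B _].
    rewrite Rmin_left in B by (pose proof (exp_ineq1_le (Rabs y)); lra).
    apply sqrt_le_1_alt in B. rewrite sqrt_1 in B. nra.
Qed.

(** * The inverse chart from the radial coordinate back to [u] *)

Definition chart : R -> R :=
  proj1_sig (increasing_inverse radial radial_deriv (fun y => - (y ^ 2 / 2 + 1)) Rabs
    radial_is_derive radial_deriv_pos radial_surjective).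

Definition chart_deriv (h : R) : R := / radial_deriv (chart h).

Lemma radial_chart (h : R) : radial (chart h) = h.
Proof. unfold chart. now destruct increasing_inverse as [g [H [H' D]]]. Qed.

Lemma chart_radial (u : R) : chart (radial u) = u.
Proof. unfold chart. now destruct increasing_inverse as [g [H [H' D]]]. Qed.

Lemma chart_is_derive (h : R) : is_derive chart h (chart_deriv h).
Proof.
  unfold chart_deriv, chart. now destruct increasing_inverse as [g [H [H' D]]].
Qed.

Lemma chart_deriv_pos (h : R) : 0 < chart_deriv h.
Proof. apply Rinv_0_lt_compat, radial_deriv_pos. Qed.

Lemma chart_continuous (h : R) : continuity_pt chart h.
Proof. exact (is_derive_continuity_pt _ _ _ (chart_is_derive h)). Qed.

Lemma chart_deriv_continuous (h : R) : continuity_pt chart_deriv h.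
Proof.
  apply (continuity_pt_inv (fun h => radial_deriv (chart h))).
  - apply (continuity_pt_comp chart radial_deriv).
    + apply chart_continuous.
    + apply radial_deriv_continuous.
  - apply Rgt_not_eq, radial_deriv_pos.
Qed.

Lemma chart_lt (x y : R) : x < y -> chart x < chart y.
Proof.
  apply derive_pos_increasing with chart_deriv;
    [apply chart_is_derive|apply chart_deriv_pos].
Qed.

Lemma chart_le (x y : R) : x <= y -> chart x <= chart y.
Proof. intros [L| ->]; [left; now apply chart_lt|right; reflexivity]. Qed.

Lemma chart_0 : chart 0 = 0.
Proof.
  replace 0 with (radial 0) at 1 by (unfold radial; ring). apply chart_radial.
Qed.

Lemma potential_chart (h : R) : potential (chart h) = h ^ 2 / 2.
Proof. pose proof (radial_sqr (chart h)) as E. rewrite radial_chart in E. lra. Qed.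

(** This is the derivative of [potential (chart h) = h ^ 2 / 2]. Reading it off the factorizations
    through the ratios covers [h = 0] without a separate case. *)
Lemma chart_deriv_force (h : R) : chart_deriv h * (exp (chart h) - 1) = h.
Proof.
  unfold chart_deriv, radial_deriv. rewrite <- force_ratio_mul.
  transitivity (radial (chart h)); [|apply radial_chart].
  unfold radial. field. split.
  - apply Rgt_not_eq, sqrt_lt_R0, potential_ratio_pos.
  - apply Rgt_not_eq, force_ratio_pos.
Qed.

Lemma chart_negative (h : R) : h < 0 -> chart h <= - (h ^ 2 / 2).
Proof.
  intros L. pose proof (potential_chart h) as E. unfold potential in E.
  assert (C : chart h < 0) by (rewrite <- chart_0; now apply chart_lt).
  apply exp_increasing in C. rewrite exp_0 in C. lra.
Qed.

(* [auto_derive] leaves eta-expanded derivatives of opaque functions. *)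
Ltac rewrite_derive H :=
  match type of H with is_derive ?f ?x ?l =>
    rewrite (is_derive_unique (fun z : R => f z) x l H)
  end.

(** * Integrals of continuous functions *)

Lemma continuity_pt_continuous (f : R -> R) (x : R) :
  continuity_pt f x -> continuous f x.
Proof. apply continuity_pt_filterlim. Qed.

Lemma ex_RInt_continuity (f : R -> R) (a b : R) : continuity f -> ex_RInt f a b.
Proof.
  intros H. apply (ex_RInt_continuous (V := R_CompleteNormedModule)).
  intros z _. apply continuity_pt_continuous, H.
Qed.

Lemma RInt_is_derive (f : R -> R) (a x : R) :
  continuity f -> is_derive (fun y => RInt f a y) x (f x).
Proof.
  intros H. apply (is_derive_RInt f (fun y => RInt f a y) a x).
  - apply filter_forall. intros y. apply (RInt_correct (V := R_CompleteNormedModule)).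
    now apply ex_RInt_continuity.
  - apply continuity_pt_continuous, H.
Qed.

Lemma is_RInt_antiderivative (F f : R -> R) (a b : R) :
  (forall x, is_derive F x (f x)) -> continuity f -> is_RInt f a b (F b - F a).
Proof.
  intros D C. apply (is_RInt_derive (V := R_CompleteNormedModule)); intros x _.
  - apply D.
  - apply continuity_pt_continuous, C.
Qed.

Lemma RInt_pointwise (f g : R -> R) (a b : R) :
  (forall t, f t = g t) -> RInt f a b = RInt g a b.
Proof. intros H. apply RInt_ext. intros t _. apply H. Qed.

Lemma continuity_comp_rcos (f : R -> R) (r : R) :
  continuity f -> continuity (fun t => f (r * cos t)).
Proof.
  intros H x. apply (continuity_pt_comp (fun t => r * cos t) f); [|apply H].
  apply (continuity_pt_scal cos r x), continuity_cos.
Qed.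

(** With [F] the integral from 0, the sum [F t + F (2 * PI - t)] has zero derivative; its values at
    0 and at [PI] are compared. *)
Lemma RInt_even_about_PI (f : R -> R) :
  continuity f -> (forall t, f (2 * PI - t) = f t) ->
  RInt f 0 (2 * PI) = 2 * RInt f 0 PI.
Proof.
  intros C E. set (F := fun t => RInt f 0 t).
  assert (H : F 0 + F (2 * PI - 0) = F PI + F (2 * PI - PI)).
  { apply (derive_zero_constant (fun t => F t + F (2 * PI - t))). intros t.
    assert (D : forall z, is_derive F z (f z)) by (intros z; now apply RInt_is_derive).
    auto_derive.
    - split; [eexists; apply D|split; [eexists; apply D|easy]].
    - rewrite_derive (D t).
      replace (2 * PI + - t) with (2 * PI - t) by ring.
      rewrite_derive (D (2 * PI - t)). rewrite E. ring. }
  assert (F0 : F 0 = 0) by apply (RInt_point (V := R_CompleteNormedModule)).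
  replace (2 * PI - PI) with PI in H by ring.
  rewrite F0, Rminus_0_r in H. change (F (2 * PI) = 2 * F PI). lra.
Qed.

(** * Half period and action as integrals over the phase angle *)

(** The orbit of energy [r ^ 2 / 2] is [u = chart (r * cos t)], [u' = - r * sin t], so the time
    element is [chart_deriv (r * cos t)] times [dt]. Angles from 0 to [PI] run from the maximum of
    [u] to its minimum. *)
Definition half_period (r : R) : R := RInt (fun t => chart_deriv (r * cos t)) 0 PI.

(** Half the enclosed area in the form obtained after integration by parts. Only [chart] occurs,
    whose derivative is continuous, so the integral can be differentiated in [r]. *)
Definition action (r : R) : R := RInt (fun t => r * cos t * chart (r * cos t)) 0 PI.

Lemma continuity_chart_deriv_rcos (r : R) :
  continuity (fun t => chart_deriv (r * cos t)).
Proof. apply continuity_comp_rcos. intros h. apply chart_deriv_continuous. Qed.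

Lemma continuity_chart_rcos (r : R) : continuity (fun t => chart (r * cos t)).
Proof. apply continuity_comp_rcos. intros h. apply chart_continuous. Qed.

Lemma continuity_sin_sqr (r : R) : continuity (fun t => (r * sin t) ^ 2).
Proof.
  intros t. apply is_derive_continuity_pt with (r * cos t * (r * sin t) * 2).
  auto_derive; [easy|ring].
Qed.

Lemma continuity_action_density (r : R) :
  continuity (fun t => (r * sin t) ^ 2 * chart_deriv (r * cos t)).
Proof.
  apply (continuity_mult (fun t => (r * sin t) ^ 2)).
  - apply continuity_sin_sqr.
  - apply continuity_chart_deriv_rcos.
Qed.

Lemma chart_rcos_is_derive (r t : R) :
  is_derive (fun t => chart (r * cos t)) t (- (r * sin t) * chart_deriv (r * cos t)).
Proof.
  auto_derive.
  - repeat apply conj; try easy; eexists; apply chart_is_derive.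
  - rewrite_derive (chart_is_derive (r * cos t)). ring.
Qed.

(** The boundary term [sin t * chart (r * cos t)] vanishes at both ends. *)
Lemma sin_chart_by_parts (r : R) :
  RInt (fun t => cos t * chart (r * cos t)) 0 PI =
  RInt (fun t => r * sin t ^ 2 * chart_deriv (r * cos t)) 0 PI.
Proof.
  assert (C1 : continuity (fun t => cos t * chart (r * cos t)))
    by (apply (continuity_mult cos); [apply continuity_cos|apply continuity_chart_rcos]).
  assert (C2 : continuity (fun t => r * sin t ^ 2 * chart_deriv (r * cos t))).
  { apply (continuity_mult (fun t => r * sin t ^ 2)).
    - intros t. apply is_derive_continuity_pt with (r * cos t * sin t * 2).
      auto_derive; [easy|ring].
    - apply continuity_chart_deriv_rcos. }
  assert (H : RInt (fun t => cos t * chart (r * cos t) -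
                             r * sin t ^ 2 * chart_deriv (r * cos t)) 0 PI = 0).
  { apply is_RInt_unique.
    replace 0 with (sin PI * chart (r * cos PI) - sin 0 * chart (r * cos 0)) at 2
      by (rewrite sin_PI, sin_0; ring).
    apply (is_RInt_antiderivative (fun t => sin t * chart (r * cos t))).
    - intros t. pose proof (chart_rcos_is_derive r t) as D. auto_derive.
      + repeat apply conj; try easy; eexists; apply chart_is_derive.
      + rewrite_derive (chart_is_derive (r * cos t)). ring.
    - now apply (continuity_minus (fun t => cos t * chart (r * cos t))). }
  rewrite (RInt_minus (V := R_CompleteNormedModule)
    (fun t => cos t * chart (r * cos t))) in H; try now apply ex_RInt_continuity.
  change (RInt (fun t => cos t * chart (r * cos t)) 0 PI -
    RInt (fun t => r * sin t ^ 2 * chart_deriv (r * cos t)) 0 PI = 0) in H. lra.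
Qed.

Lemma action_density (r : R) :
  action r = RInt (fun t => (r * sin t) ^ 2 * chart_deriv (r * cos t)) 0 PI.
Proof.
  unfold action.
  transitivity (r * RInt (fun t => cos t * chart (r * cos t)) 0 PI).
  - rewrite <- (RInt_scal (V := R_CompleteNormedModule)).
    + apply RInt_pointwise. intros t. change scal with Rmult. simpl. ring.
    + apply ex_RInt_continuity, (continuity_mult cos);
        [apply continuity_cos|apply continuity_chart_rcos].
  - rewrite sin_chart_by_parts, <- (RInt_scal (V := R_CompleteNormedModule)).
    + apply RInt_pointwise. intros t. change scal with Rmult. simpl. ring.
    + apply ex_RInt_continuity, (continuity_mult (fun t => r * sin t ^ 2)).
      * intros t. apply is_derive_continuity_pt with (r * cos t * sin t * 2).
        auto_derive; [easy|ring].
      * apply continuity_chart_deriv_rcos.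
Qed.

(** Differentiation under the integral produces a [cos t * chart] term and a [cos t ^ 2] term.
    Integration by parts turns the first into a [sin t ^ 2] term with the same weight, and the
    squares add up to 1. *)
Lemma action_is_derive (r : R) : is_derive action r (r * half_period r).
Proof.
  set (k := fun h => chart h + h * chart_deriv h).
  assert (D : forall r t : R,
    is_derive (fun z : R => z * cos t * chart (z * cos t)) r (cos t * k (r * cos t))).
  { intros z t. unfold k. auto_derive.
    - repeat apply conj; try easy; eexists; apply chart_is_derive.
    - rewrite_derive (chart_is_derive (z * cos t)). ring. }
  assert (Ck : continuity k).
  { apply (continuity_plus chart).
    - intros h. apply chart_continuous.
    - apply (continuity_mult (fun h => h)).
      + apply derivable_continuous, derivable_id.
      + intros h. apply chart_deriv_continuous. }
  replace (r * half_period r) with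
    (RInt (fun t => Derive (fun z => z * cos t * chart (z * cos t)) r) 0 PI).
  - apply (is_derive_RInt_param (fun z t => z * cos t * chart (z * cos t))).
    + apply filter_forall. intros z t _. eexists. apply D.
    + intros t _.
      apply continuity_2d_pt_ext with (fun z t => cos t * k (z * cos t)).
      { intros z s. symmetry. apply is_derive_unique, D. }
      assert (Cc : continuity_2d_pt (fun _ t => cos t) r t)
        by (apply (continuity_1d_2d_pt_comp cos (fun _ t => t));
            [apply continuity_cos|apply continuity_2d_pt_id2]).
      apply continuity_2d_pt_mult; [exact Cc|].
      apply (continuity_1d_2d_pt_comp k (fun z t => z * cos t)); [apply Ck|].
      apply continuity_2d_pt_mult; [apply continuity_2d_pt_id1|exact Cc].
    + apply filter_forall. intros z. apply ex_RInt_continuity.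
      apply (continuity_mult (fun t => z * cos t)); [|apply continuity_chart_rcos].
      apply (continuity_scal cos z), continuity_cos.
  - rewrite (RInt_pointwise _ (fun t => cos t * chart (r * cos t) +
        r * cos t ^ 2 * chart_deriv (r * cos t)))
      by (intros t; rewrite (is_derive_unique _ _ _ (D r t)); unfold k; ring).
    assert (C1 : continuity (fun t => cos t * chart (r * cos t)))
      by (apply (continuity_mult cos); [apply continuity_cos|apply continuity_chart_rcos]).
    assert (Cq : forall f : R -> R, (f = sin \/ f = cos) ->
      continuity (fun t => r * f t ^ 2 * chart_deriv (r * cos t))).
    { intros f Hf. apply (continuity_mult (fun t => r * f t ^ 2)).
      - intros t. destruct Hf; subst f;
        [apply is_derive_continuity_pt with (r * cos t * sin t * 2)
        |apply is_derive_continuity_pt with (- (r * sin t * cos t * 2))];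
        auto_derive; try easy; ring.
      - apply continuity_chart_deriv_rcos. }
    rewrite (RInt_plus (V := R_CompleteNormedModule)
      (fun t => cos t * chart (r * cos t))); try apply ex_RInt_continuity; auto.
    rewrite sin_chart_by_parts.
    rewrite <- (RInt_plus (V := R_CompleteNormedModule)); try apply ex_RInt_continuity; auto.
    unfold half_period.
    change (r * RInt (fun t => chart_deriv (r * cos t)) 0 PI) with
      (scal r (RInt (fun t => chart_deriv (r * cos t)) 0 PI)).
    rewrite <- (RInt_scal (V := R_CompleteNormedModule))
      by apply ex_RInt_continuity, continuity_chart_deriv_rcos.
    apply RInt_pointwise. intros t. change scal with Rmult. change plus with Rplus. simpl.
    pose proof (sin2_cos2 t) as E. unfold Rsqr in E.
    transitivity (r * (sin t * sin t + cos t * cos t) * chart_deriv (r * cos t)); [ring|].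
    rewrite E. ring.
Qed.

(** * Selecting an orbit of prescribed half period by minimization *)

(** Inserting the factor [sin t <= 1] makes the integrand exact, with value
    [(chart r - chart (- r)) / r]; the left turning point lies below [- r ^ 2 / 2]. This growth
    gives the minimization its coercivity. *)
Lemma half_period_ge (r : R) : 0 < r -> r / 2 <= half_period r.
Proof.
  intros Hr.
  assert (I : is_RInt (fun t => sin t * chart_deriv (r * cos t)) 0 PI
                ((chart r - chart (- r)) / r)).
  { replace ((chart r - chart (- r)) / r) with
      (- chart (r * cos PI) / r - - chart (r * cos 0) / r)
      by (rewrite cos_PI, cos_0; replace (r * -1) with (- r) by ring;
          rewrite Rmult_1_r; field; lra).
    apply (is_RInt_antiderivative (fun t => - chart (r * cos t) / r)).
    - intros t. auto_derive.
      + repeat apply conj; try easy; eexists; apply chart_is_derive.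
      + rewrite_derive (chart_is_derive (r * cos t)). field. lra.
    - apply (continuity_mult sin);
        [apply continuity_sin|apply continuity_chart_deriv_rcos]. }
  apply Rle_trans with ((chart r - chart (- r)) / r).
  - assert (0 < chart r) by (rewrite <- chart_0; apply chart_lt, Hr).
    pose proof (chart_negative (- r) ltac:(lra)) as N.
    replace ((- r) ^ 2) with (r * r) in N by ring.
    apply (proj1 (Rle_div_r _ _ _ Hr)). lra.
  - rewrite <- (is_RInt_unique _ _ _ _ I). apply RInt_le.
    + apply Rlt_le, PI_RGT_0.
    + eexists. exact I.
    + apply ex_RInt_continuity, continuity_chart_deriv_rcos.
    + intros t _. pose proof (SIN_bound t). pose proof (chart_deriv_pos (r * cos t)). nra.
Qed.

(* [action r - tau r^2 / 2] is the Legendre transform of the action in the energy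
   variable [r^2 / 2]; its critical points are the orbits of half period [tau]. *)
Lemma half_period_minimizer (tau r1 : R) :
  0 < tau -> 0 < r1 -> action r1 - tau * r1 ^ 2 / 2 < 0 ->
  exists r, 0 < r /\ half_period r = tau /\
    action r - tau * r ^ 2 / 2 <= action r1 - tau * r1 ^ 2 / 2.
Proof.
  intros Ht Hr1 Hneg.
  set (F := fun r => action r - tau * r ^ 2 / 2).
  assert (D : forall r, is_derive F r (r * (half_period r - tau))).
  { intros r. unfold F. pose proof (action_is_derive r) as D. auto_derive.
    - repeat apply conj; try easy; eexists; apply D.
    - rewrite_derive D. field. }
  assert (F0 : F 0 = 0).
  { unfold F, action.
    rewrite (RInt_pointwise _ (fun _ => 0)) by (intros; ring).
    rewrite RInt_const. change scal with Rmult. simpl. field. }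
  (* Beyond [R0 > 2 * tau] the half period exceeds [tau], so [F] increases strictly there and the
     right end [R0 + 1] cannot be a minimum. The left end 0 is excluded because [F 0 = 0] while
     [F r1 < 0]. *)
  assert (HR : exists R0, r1 < R0 /\ 2 * tau < R0).
  { exists (Rmax r1 (2 * tau) + 1).
    pose proof (Rmax_l r1 (2 * tau)). pose proof (Rmax_r r1 (2 * tau)). lra. }
  destruct HR as [R0 [B1 B2]].
  destruct (continuity_ab_min F 0 (R0 + 1)) as [r [Hmin Hr]].
  { lra. }
  { intros c _. exact (is_derive_continuity_pt _ _ _ (D c)). }
  assert (Fr : F r <= F r1) by (apply Hmin; lra).
  assert (N0 : r <> 0) by (intros ->; unfold F in *; lra).
  assert (NR : r <> R0 + 1).
  { intros ->. destruct (mean_value F _ R0 (R0 + 1) D) as [c [Hc E]].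
    rewrite Rmin_left, Rmax_right in Hc by lra.
    pose proof (half_period_ge c ltac:(lra)).
    pose proof (Hmin R0 ltac:(lra)) as M.
    assert (0 < c * (half_period c - tau)) by (apply Rmult_lt_0_compat; lra).
    cbv beta in E. lra. }
  exists r. split; [lra|]. split; [|exact Fr].
  assert (Z : r * (half_period r - tau) = 0).
  { assert (pr : derivable_pt F r)

      by (exists (r * (half_period r - tau)); apply is_derive_Reals, D).
    rewrite <- (deriv_minimum F 0 (R0 + 1) r pr); [|lra|lra|].
    - symmetry. rewrite Derive_Reals. apply is_derive_unique, D.
    - intros x Hx0 Hx1. apply Hmin. lra. }
  apply Rmult_integral in Z. lra.
Qed.

(** * Construction of the periodic orbit in the time variable *)

(** Time is first computed as a function of the angle. Its inverse [th] turns the explicit angular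
    parametrization into a solution, and the shift of [th] by [2 * PI] gives periodicity. *)
Lemma periodic_orbit (r : R) : 0 < r ->
  exists u v : R -> R,
    (forall s, is_derive u s (v s)) /\
    (forall s, is_derive v s (1 - exp (u s))) /\
    (forall s, u (s + 2 * half_period r) = u s) /\
    (forall s, u s <= u 0) /\
    is_RInt (fun s => u s * (1 + exp (u s)) / 2) 0 (2 * half_period r)
      (2 * (action r - half_period r * r ^ 2 / 2)).
Proof.
  intros Hr.
  set (p := fun t => chart_deriv (r * cos t)).
  assert (Cp : continuity p) by apply continuity_chart_deriv_rcos.
  assert (Pp : forall t, 0 < p t) by (intros t; apply chart_deriv_pos).
  set (time := fun t => RInt p 0 t).
  assert (Dt : forall t, is_derive time t (p t)) by (intros t; now apply RInt_is_derive).
  assert (T0 : time 0 = 0) by apply (RInt_point (V := R_CompleteNormedModule)).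
  assert (T2 : time (2 * PI) = 2 * half_period r).
  { apply RInt_even_about_PI; [exact Cp|]. intros t. unfold p.
    replace (2 * PI - t) with (- t + 2 * PI) by ring.
    rewrite cos_plus, cos_2PI, sin_2PI, cos_neg. f_equal. ring. }
  assert (Tper : forall t, time (t + 2 * PI) = time t + 2 * half_period r).
  { intros t.
    assert (H : time (t + 2 * PI) - time t = time (0 + 2 * PI) - time 0).
    { apply (derive_zero_constant (fun t => time (t + 2 * PI) - time t)). intros z.
      auto_derive.
      - repeat apply conj; try easy; eexists; apply Dt.
      - rewrite_derive (Dt z). rewrite_derive (Dt (z + 2 * PI)). unfold p.
        rewrite cos_plus, cos_2PI, sin_2PI.
        replace (cos z * 1 - sin z * 0) with (cos z) by ring. ring. }
    rewrite Rplus_0_l, T0, T2 in H. lra. }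
  (* A positive minimum of [chart_deriv] on the compact range makes time grow at least linearly,
     which supplies the brackets for the inverse. *)
  destruct (continuity_ab_min chart_deriv (- r) r) as [h0 [Hm _]];
    [lra|intros c _; apply chart_deriv_continuous|].
  set (m := chart_deriv h0).
  assert (Pm : 0 < m) by apply chart_deriv_pos.
  assert (Lp : forall t, m <= p t).
  { intros t. apply Hm. pose proof (COS_bound t). nra. }
  assert (Surj : forall y, time (- Rabs y / m) <= y <= time (Rabs y / m)).
  { intros y. pose proof (Rabs_pos y) as Py.
    assert (B : forall z, exists c, time z = p c * z).
    { intros z. destruct (mean_value time p 0 z Dt) as [c [_ E]]. exists c. lra. }
    assert (Q : 0 <= Rabs y / m) by (apply Rdiv_le_0_compat; lra).
    assert (E : m * (Rabs y / m) = Rabs y) by (field; lra).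
    replace (- Rabs y / m) with (- (Rabs y / m)) by (field; lra).
    destruct (B (Rabs y / m)) as [c1 E1]. destruct (B (- (Rabs y / m))) as [c2 E2].
    pose proof (Lp c1). pose proof (Lp c2). rewrite E1, E2.
    pose proof (Rle_abs y). pose proof (Rle_abs (- y)) as N. rewrite Rabs_Ropp in N.
    split; nra. }
  destruct (increasing_inverse time p _ _ Dt Pp Surj) as [th [Eth [Eth' Dth]]].
  set (u := fun s => chart (r * cos (th s))).
  set (v := fun s => - (r * sin (th s))).
  assert (th0 : th 0 = 0) by (rewrite <- T0 at 1; apply Eth').
  assert (thper : forall s, th (s + 2 * half_period r) = th s + 2 * PI).
  { intros s. rewrite <- (Eth' (th s + 2 * PI)), Tper, Eth. reflexivity. }
  assert (Du : forall s, is_derive u s (v s)).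
  { intros s. unfold u, v.
    pose proof (Pp (th s)) as P.
    replace (- (r * sin (th s))) with
      (scal (/ p (th s)) (- (r * sin (th s)) * chart_deriv (r * cos (th s)))).
    - apply (is_derive_comp (fun t => chart (r * cos t)) th).
      + apply chart_rcos_is_derive.
      + apply Dth.
    - change scal with Rmult. simpl. fold (p (th s)). field. lra. }
  assert (Dv : forall s, is_derive v s (1 - exp (u s))).
  { intros s. unfold v. pose proof (Pp (th s)) as P.
    pose proof (chart_deriv_force (r * cos (th s))) as E. fold (p (th s)) in E.
    fold (u s) in E. pose proof (Dth s) as D. auto_derive.
    - repeat apply conj; try easy; eexists; apply D.
    - rewrite_derive D. apply Rmult_eq_reg_l with (p (th s)); [|lra].
      transitivity (- (r * cos (th s))); [field; lra|lra]. }
  exists u, v. repeat apply conj; auto.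
  - intros s. unfold u. rewrite thper, cos_plus, cos_2PI, sin_2PI. f_equal. ring.
  - intros s. unfold u. apply chart_le. rewrite th0, cos_0.
    pose proof (COS_bound (th s)). nra.
  - set (V := fun t => RInt (fun t => (r * sin t) ^ 2 * p t) 0 t).
    assert (DV : forall t, is_derive V t ((r * sin t) ^ 2 * p t)).
    { intros t. apply (RInt_is_derive (fun t => (r * sin t) ^ 2 * p t)).
      apply continuity_action_density. }
    assert (V0 : V 0 = 0) by apply (RInt_point (V := R_CompleteNormedModule)).
    assert (V2 : V (2 * PI) = 2 * action r).
    { rewrite action_density. apply RInt_even_about_PI.
      - apply continuity_action_density.
      - intros t. unfold p. replace (2 * PI - t) with (- t + 2 * PI) by ring.
        rewrite cos_plus, sin_plus, cos_2PI, sin_2PI, cos_neg, sin_neg.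
        replace (cos t * 1 - - sin t * 0) with (cos t) by ring. ring. }
    (* Energy conservation makes this an antiderivative of [u * (1 + exp u) / 2]. The terms
       containing [v] vanish at both ends of the period, leaving only the action and the energy. *)
    set (F := fun s => V (th s) - r ^ 2 / 2 * s - v s - u s * v s / 2).
    assert (thT : th (2 * half_period r) = 2 * PI)
      by (rewrite <- (Rplus_0_l (2 * half_period r)), thper, th0; ring).
    replace (2 * (action r - half_period r * r ^ 2 / 2)) with
      (F (2 * half_period r) - F 0).
    2:{ unfold F, v. rewrite thT, th0, V0, V2, sin_2PI, sin_0. field. }
    apply is_RInt_antiderivative.
    + intros s. unfold F.
      pose proof (Du s) as D1. pose proof (Dv s) as D2. pose proof (DV (th s)) as D3.
      pose proof (Dth s) as D4. pose proof (Pp (th s)) as P.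
      auto_derive.
      * repeat apply conj; try easy; eexists; eassumption.
      * rewrite_derive D1. rewrite_derive D2. rewrite_derive D3. rewrite_derive D4.
        pose proof (potential_chart (r * cos (th s))) as E. fold (u s) in E.
        unfold potential in E.
        pose proof (sin2_cos2 (th s)) as S2. unfold Rsqr in S2.
        assert (Ev : v s ^ 2 = r ^ 2 - (r * cos (th s)) ^ 2).
        { unfold v. replace (r ^ 2) with (r ^ 2 * 1) at 1 by ring. rewrite <- S2. ring. }
        transitivity ((r * sin (th s)) ^ 2 - r ^ 2 / 2 - (1 - exp (u s))
          - (v s ^ 2 + u s * (1 - exp (u s))) / 2); [field; lra|].
        replace ((r * sin (th s)) ^ 2) with (v s ^ 2) by (unfold v; ring).
        lra.
    + intros s. pose proof (Du s) as D1.
      apply is_derive_continuity_pt with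
        (v s * (1 + exp (u s)) / 2 + u s * (v s * exp (u s)) / 2).
      auto_derive.
      * repeat apply conj; try easy; eexists; eassumption.
      * rewrite_derive D1. field.
Qed.

(** * Upper bound for the action of the trial orbit *)

Lemma exp_nondecreasing (x y : R) : x <= y -> exp x <= exp y.
Proof. intros [L| ->]; [left; now apply exp_increasing|right; reflexivity]. Qed.

(* Antiderivative of [sqrt (A + t) - sqrt A * (1 - sqrt (1 - exp t))], an upper bound
   for [sqrt (A + t - A * exp t)]. *)
Definition trial_primitive (A t : R) : R :=
  2 / 3 * ((A + t) * sqrt (A + t)) -
  sqrt A * (2 * ln (1 + sqrt (1 - exp t)) - 2 * sqrt (1 - exp t)).

Lemma trial_primitive_is_derive (A t : R) : t < 0 -> 0 < A + t ->
  is_derive (trial_primitive A) t (sqrt (A + t) - sqrt A * (1 - sqrt (1 - exp t))).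
Proof.
  intros Ht HA.
  assert (He : exp t < 1) by (rewrite <- exp_0; now apply exp_increasing).
  assert (Py : 0 < sqrt (1 - exp t)) by (apply sqrt_lt_R0; lra).
  assert (Pd : 0 < sqrt (A + t)) by now apply sqrt_lt_R0.
  assert (E1 : sqrt (A + t) * sqrt (A + t) = A + t) by (apply sqrt_sqrt; lra).
  assert (E2 : exp t = 1 - sqrt (1 - exp t) * sqrt (1 - exp t))
    by (rewrite sqrt_sqrt; lra).
  unfold trial_primitive. auto_derive.
  - change (1 + - exp t) with (1 - exp t). repeat apply conj; try easy; lra.
  - replace (1 + - exp t) with (1 - exp t) by ring.
    set (y := sqrt (1 - exp t)) in *. set (d := sqrt (A + t)) in *.
    rewrite E2. rewrite <- E1. field. lra.
Qed.

(** Unlike the derivative formula, this includes the turning point [t = 0], where [sqrt (1 - exp t)]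
    is not differentiable; the mean value theorem needs continuity there. *)
Lemma trial_primitive_continuous (A t : R) : t <= 0 -> 0 < A + t ->
  continuity_pt (trial_primitive A) t.
Proof.
  intros Ht HA.
  assert (He : exp t <= 1) by (rewrite <- exp_0; now apply exp_nondecreasing).
  assert (Cy : continuity_pt (fun t => sqrt (1 - exp t)) t).
  { apply (continuity_pt_comp (fun t => 1 - exp t) sqrt).
    - apply is_derive_continuity_pt with (- exp t). auto_derive; [easy|ring].
    - apply continuity_pt_sqrt. lra. }
  apply (continuity_pt_minus (fun t => 2 / 3 * ((A + t) * sqrt (A + t)))).
  - apply continuity_pt_filterlim.
    apply (ex_derive_continuous (V := R_NormedModule)
             (fun t => 2 / 3 * ((A + t) * sqrt (A + t)))).
    auto_derive. easy.
  - apply (continuity_pt_scal (fun t => 2 * ln (1 + sqrt (1 - exp t)) -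
                                        2 * sqrt (1 - exp t))).
    apply (continuity_pt_comp (fun t => sqrt (1 - exp t)) (fun y => 2 * ln (1 + y) - 2 * y));
      [exact Cy|].
    pose proof (sqrt_pos (1 - exp t)).
    apply is_derive_continuity_pt with (2 / (1 + sqrt (1 - exp t)) - 2).
    auto_derive; [lra|field; lra].
Qed.

(** The letters stand for [a = sqrt A], [d = sqrt (A + t)], [y = sqrt (1 - exp t)], and [v] for the
    speed over [sqrt 2]. Since [d ^ 2 - v ^ 2] factors as [a * (1 - y)] times [a * (1 + y)], and
    [d + v <= a * (1 + y)], dividing by [d + v] gives the claim. *)
Lemma trial_speed (a d v y z : R) :
  0 < a -> 0 < d <= a -> 0 <= v -> v ^ 2 <= a ^ 2 * y ^ 2 -> 0 <= y <= 1 ->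
  y ^ 2 = 1 - z -> d ^ 2 = v ^ 2 + a ^ 2 * z -> v <= d - a * (1 - y).
Proof.
  intros Ha Hd Hv Hvy Hy Ey Ed.
  assert (V : v <= a * y).
  { apply Rsqr_incr_0_var; [unfold Rsqr; lra|apply Rmult_le_pos; lra]. }
  assert (P : a * (1 - y) * (d + v) <= (d - v) * (d + v)).
  { replace ((d - v) * (d + v)) with (a * (1 - y) * (a * (1 + y)))
      by (transitivity (d ^ 2 - v ^ 2); [nra|ring]).
    apply Rmult_le_compat_l; [nra|lra]. }
  apply Rmult_le_reg_r in P; lra.
Qed.

Lemma action_upper_bound (A : R) : 1 < A ->
  exists r, 0 < r /\ r ^ 2 / 2 = A - ln A - 1 /\
    action r <= sqrt 2 * (2 / 3 * (A * sqrt A) - 2 * (1 - ln 2) * sqrt A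
                          + sqrt A * exp (1 - A)).
Proof.
  intros HA.
  assert (HlA : 0 < ln A) by (rewrite <- ln_1; apply ln_increasing; lra).
  assert (EA : exp (ln A) = A) by (apply exp_ln; lra).
  set (r := radial (ln A)). exists r.
  assert (Er : r ^ 2 / 2 = A - ln A - 1)
    by (unfold r; rewrite radial_sqr; unfold potential; rewrite EA; field).
  assert (Hr : 0 < r).
  { unfold r, radial. apply Rmult_lt_0_compat; [exact HlA|].
    apply sqrt_lt_R0, potential_ratio_pos. }
  split; [exact Hr|]. split; [exact Er|].
  set (a := sqrt A).
  assert (Pa : 0 < a) by (apply sqrt_lt_R0; lra).
  assert (Ea : a ^ 2 = A) by (apply pow2_sqrt; lra).
  set (w := sqrt 2).
  assert (Pw : 0 < w) by (apply sqrt_lt_R0; lra).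
  assert (Ew : w ^ 2 = 2) by (apply pow2_sqrt; lra).
  set (u := fun t => chart (r * cos t)).
  set (tau := fun t => u t - ln A).
  assert (Hchart : chart r = ln A) by apply chart_radial.
  assert (Htau : forall t, tau t <= 0).
  { intros t. unfold tau, u. rewrite <- Hchart.
    assert (chart (r * cos t) <= chart r); [|lra].
    apply chart_le. pose proof (COS_bound t). nra. }
  assert (Eu : forall t, exp (u t) = A * exp (tau t)).
  { intros t. rewrite <- EA at 1. rewrite <- exp_plus. f_equal. unfold tau. ring. }
  assert (En : forall t, A + tau t = (r * sin t) ^ 2 / 2 + A * exp (tau t)).
  { intros t. pose proof (potential_chart (r * cos t)) as E. unfold potential in E.
    fold (u t) in E. rewrite Eu in E.
    pose proof (sin2_cos2 t) as S2. unfold Rsqr in S2.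
    assert (r ^ 2 / 2 = (r * sin t) ^ 2 / 2 + (r * cos t) ^ 2 / 2).
    { replace (r ^ 2 / 2) with (r ^ 2 / 2 * 1) by ring. rewrite <- S2. field. }
    unfold tau at 1. lra. }
  assert (HD : forall t, 0 < A + tau t).
  { intros t. rewrite En. pose proof (exp_pos (tau t)). nra. }
  set (V := fun t => RInt (fun t => (r * sin t) ^ 2 * chart_deriv (r * cos t)) 0 t).
  assert (DV : forall t, is_derive V t ((r * sin t) ^ 2 * chart_deriv (r * cos t))).
  { intros t. apply (RInt_is_derive (fun t => (r * sin t) ^ 2 * chart_deriv (r * cos t))).
    apply continuity_action_density. }
  assert (V0 : V 0 = 0) by apply (RInt_point (V := R_CompleteNormedModule)).
  assert (Dtau : forall t, is_derive tau t (- (r * sin t) * chart_deriv (r * cos t))).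
  { intros t. pose proof (chart_rcos_is_derive r t) as D. unfold tau, u. auto_derive.
    - repeat apply conj; try easy; eexists; apply chart_is_derive.
    - rewrite_derive (chart_is_derive (r * cos t)). ring. }
  set (M := fun t => sqrt (A + t) - a * (1 - sqrt (1 - exp t))).
  (* The area swept so far is compared with the primitive of the speed bound. The derivative of [Z]
     is nonpositive because [r * sin t <= w * M (tau t)], so [Z] does not rise from 0 to [PI]. *)
  set (Z := fun t => V t + w * trial_primitive A (tau t)).
  assert (DZ : forall t, 0 < t < PI -> is_derive Z t
    ((r * sin t) ^ 2 * chart_deriv (r * cos t)
     + w * ((- (r * sin t) * chart_deriv (r * cos t)) * M (tau t)))).
  { intros t Ht. unfold Z.
    assert (N : tau t < 0).
    { unfold tau, u. rewrite <- Hchart.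
      assert (chart (r * cos t) < chart r); [|lra].
      apply chart_lt. rewrite <- (Rmult_1_r r) at 2. apply Rmult_lt_compat_l; [exact Hr|].
      rewrite <- cos_0. apply cos_decreasing_1; lra. }
    pose proof (is_derive_comp (trial_primitive A) tau t _ _
      (trial_primitive_is_derive A (tau t) N (HD t)) (Dtau t)) as D.
    fold a in D. fold (M (tau t)) in D.
    apply (is_derive_plus V (fun t => w * trial_primitive A (tau t))); [apply DV|].
    apply (is_derive_scal (fun t => trial_primitive A (tau t)) t w). exact D. }
  assert (CZ : forall t, continuity_pt Z t).
  { intros t. apply (continuity_pt_plus V (fun t => w * trial_primitive A (tau t))).
    - exact (is_derive_continuity_pt _ _ _ (DV t)).
    - apply (continuity_pt_scal (fun t => trial_primitive A (tau t))).
      apply (continuity_pt_comp tau (trial_primitive A)).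
      + exact (is_derive_continuity_pt _ _ _ (Dtau t)).
      + now apply trial_primitive_continuous. }
  assert (HZ : Z PI <= Z 0).
  { destruct (MVT_gen Z 0 PI (fun t => (r * sin t) ^ 2 * chart_deriv (r * cos t)
     + w * ((- (r * sin t) * chart_deriv (r * cos t)) * M (tau t)))) as [c [Hc E]].
    - intros t. rewrite Rmin_left, Rmax_right by (pose proof PI_RGT_0; lra). apply DZ.
    - intros t _. apply CZ.
    - rewrite Rmin_left, Rmax_right in Hc by (pose proof PI_RGT_0; lra).
      pose proof PI_RGT_0 as Ppi.
      pose proof (chart_deriv_pos (r * cos c)) as Pc.
      assert (Ps : 0 <= r * sin c) by (apply Rmult_le_pos; [lra|apply sin_ge_0; lra]).
      assert (He : exp (tau c) <= 1) by (rewrite <- exp_0; apply exp_nondecreasing, Htau).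
      pose proof (exp_pos (tau c)).
      assert (K : r * sin c / w <= M (tau c)).
      { pose proof (En c) as Ec.
        assert (Ev : (r * sin c / w) ^ 2 = (r * sin c) ^ 2 / 2)
          by (rewrite <- Ew; field; lra).
        assert (Ey : sqrt (1 - exp (tau c)) ^ 2 = 1 - exp (tau c)) by (apply pow2_sqrt; lra).
        assert (Ed : sqrt (A + tau c) ^ 2 = A + tau c) by (apply pow2_sqrt, Rlt_le, HD).
        apply trial_speed with (exp (tau c)); auto.
        - split; [apply sqrt_lt_R0, HD|]. apply sqrt_le_1_alt. pose proof (Htau c). lra.
        - apply Rdiv_le_0_compat; lra.
        - rewrite Ev, Ey, Ea. pose proof (Htau c). lra.
        - split; [apply sqrt_pos|].
          apply Rle_trans with (sqrt 1); [apply sqrt_le_1_alt; lra|rewrite sqrt_1; lra].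
        - rewrite Ed, Ev, Ea. exact Ec. }
      apply (Rmult_le_compat_l w) in K; [|lra].
      replace (w * (r * sin c / w)) with (r * sin c) in K by (field; lra).
      assert (Q : 0 <= (r * sin c) * chart_deriv (r * cos c) * (w * M (tau c) - r * sin c))
        by (apply Rmult_le_pos; [apply Rmult_le_pos|]; lra).
      assert (0 <= (r * sin c) * chart_deriv (r * cos c) * (w * M (tau c) - r * sin c) * PI)
        by (apply Rmult_le_pos; lra).
      lra. }
  unfold Z in HZ. rewrite V0 in HZ.
  assert (Et0 : tau 0 = 0).
  { unfold tau, u. rewrite cos_0, Rmult_1_r, Hchart. ring. }
  rewrite Et0 in HZ.
  assert (EW0 : trial_primitive A 0 = 2 / 3 * (A * a)).
  { unfold trial_primitive. rewrite exp_0, Rplus_0_r, Rminus_diag, sqrt_0, Rplus_0_r, ln_1.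
    fold a. ring. }
  rewrite EW0 in HZ.
  rewrite action_density. change (V PI <= w * (2 / 3 * (A * a) - 2 * (1 - ln 2) * a + a * exp (1 - A))).
  set (e := exp (tau PI)).
  (* At the lower turning point the speed vanishes, so [A + tau PI = exp (u PI) < 1]. *)
  assert (He : 0 < e < exp (1 - A)).
  { split; [apply exp_pos|]. apply exp_increasing.
    pose proof (En PI) as E. rewrite sin_PI in E.
    rewrite <- Eu in E.
    assert (N : exp (u PI) < 1).
    { rewrite <- exp_0. apply exp_increasing. rewrite <- chart_0. apply chart_lt.
      rewrite cos_PI. lra. }
    lra. }
  assert (He1 : e < 1).
  { pose proof (exp_increasing (1 - A) 0 ltac:(lra)) as Q. rewrite exp_0 in Q. lra. }
  set (y := sqrt (1 - e)).
  assert (Ey : y ^ 2 = 1 - e) by (apply pow2_sqrt; lra).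
  assert (Py : 0 <= y) by apply sqrt_pos.
  assert (By : 1 - e <= y <= 1) by nra.
  assert (BW : - (a * (2 * ln (1 + y) - 2 * y)) <= trial_primitive A (tau PI)).
  { unfold trial_primitive. fold e y a.
    pose proof (Rmult_le_pos _ _ (Rlt_le _ _ (HD PI)) (sqrt_pos (A + tau PI))). lra. }
  (* The tangent line of the logarithm at 2, combined with [y >= 1 - e], bounds
     [2 * ln (1 + y) - 2 * y] by [2 * ln 2 - 2 + e]. *)
  assert (Bln : ln (1 + y) <= ln 2 + (y - 1) / 2).
  { replace (1 + y) with (2 * ((1 + y) / 2)) by field. rewrite ln_mult by lra.
    assert (ln ((1 + y) / 2) <= (1 + y) / 2 - 1); [|lra].
    pose proof (exp_ineq1_le (ln ((1 + y) / 2))) as B. rewrite exp_ln in B; lra. }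
  apply Rle_trans with (w * (2 / 3 * (A * a) + a * (2 * ln (1 + y) - 2 * y))); [nra|].
  apply Rmult_le_compat_l; [lra|]. nra.
Qed.

(** * Numerical bounds and the logarithmic series *)

(** The number [exp (2 / 3)] is the sixteenth power of [exp (1 / 24) <= 24 / 23]; four squarings
    stay below 2. *)
Lemma ln_2_gt : 2 / 3 < ln 2.
Proof.
  rewrite <- (ln_exp (2 / 3)). apply ln_increasing; [apply exp_pos|].
  set (z := exp (1 / 24)).
  assert (Pz : 0 < z) by apply exp_pos.
  assert (H : z * exp (- (1 / 24)) = 1)
    by (unfold z; rewrite <- exp_plus, Rplus_opp_r; apply exp_0).
  pose proof (exp_ineq1_le (- (1 / 24))) as B.
  assert (Z1 : z <= 24 / 23) by nra.
  assert (Z2 : z * z <= 576 / 529) by nra.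
  assert (Z4 : (z * z) * (z * z) <= 1.18563) by nra.
  assert (Z8 : ((z * z) * (z * z)) * ((z * z) * (z * z)) <= 1.40572) by nra.
  replace (exp (2 / 3)) with ((((z * z) * (z * z)) * ((z * z) * (z * z))) *
    (((z * z) * (z * z)) * ((z * z) * (z * z)))).
  - nra.
  - unfold z. rewrite <- !exp_plus. f_equal. field.
Qed.

Lemma exp_5_2_gt : 11.5 < exp (5 / 2).
Proof.
  set (z := exp (5 / 128)).
  assert (Z1 : 1.0390625 <= z) by (unfold z; pose proof (exp_ineq1_le (5 / 128)); lra).
  assert (Z2 : 1.0796 <= z * z) by nra.
  set (z2 := z * z) in *.
  assert (Z4 : 1.1655 <= z2 * z2) by nra.
  set (z4 := z2 * z2) in *.
  assert (Z8 : 1.3583 <= z4 * z4) by nra.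
  set (z8 := z4 * z4) in *.
  assert (Z16 : 1.8449 <= z8 * z8) by nra.
  set (z16 := z8 * z8) in *.
  assert (Z32 : 3.4036 <= z16 * z16) by nra.
  set (z32 := z16 * z16) in *.
  replace (exp (5 / 2)) with (z32 * z32); [nra|].
  unfold z32, z16, z8, z4, z2, z. rewrite <- !exp_plus. f_equal. field.
Qed.

Lemma exp_error_bounds (x : R) : 9 / 2 <= x ->
  x * exp (2 - x) <= 4 / 10 /\
  4 * x * (exp (- 2 * x) / (1 - exp (- 2 * x)) ^ 2) <= 1 / 100.
Proof.
  intros Hx.
  assert (B : x * exp (2 - x) <= 4 / 10).
  { assert (E : exp (2 - x) * (exp (5 / 2) * exp (x - 9 / 2)) = 1).
    { rewrite <- !exp_plus, <- exp_0. f_equal. field. }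
    pose proof exp_5_2_gt as G. pose proof (exp_ineq1_le (x - 9 / 2)) as I.
    pose proof (exp_pos (2 - x)).
    (* The line [11.5 * (x - 7 / 2)] dominates [2.5 * x] from about 4.48 on, just before the
       threshold [9 / 2]. *)
    assert (P : 2.5 * x <= exp (5 / 2) * exp (x - 9 / 2)).
    { apply Rle_trans with (11.5 * (1 + (x - 9 / 2))); [lra|].
      apply Rmult_le_compat; lra. }
    nra. }
  split; [exact B|].
  set (p := exp (- x)).
  assert (Pp : 0 < p) by apply exp_pos.
  assert (E2 : exp (2 - x) = exp 1 * exp 1 * p)
    by (unfold p; rewrite <- !exp_plus; f_equal; field).
  rewrite E2 in B. pose proof (exp_ineq1_le 1) as I1.
  assert (I4 : 2 * 2 <= exp 1 * exp 1) by (apply Rmult_le_compat; lra).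
  assert (Bp : x * p <= 1 / 10).
  { assert (0 <= x * p) by (apply Rmult_le_pos; lra).
    assert (4 * (x * p) <= exp 1 * exp 1 * (x * p)) by (apply Rmult_le_compat_r; lra). lra. }
  assert (Bp' : p <= 1 / 45).
  { assert (9 / 2 * p <= x * p) by (apply Rmult_le_compat_r; lra). lra. }
  replace (exp (- 2 * x)) with (p * p)
    by (unfold p; rewrite <- exp_plus; f_equal; field).
  assert (Q : p * p <= 1 / 2025) by nra.
  assert (Q' : 0.99 <= (1 - p * p) ^ 2) by nra.
  apply Rmult_le_reg_r with ((1 - p * p) ^ 2); [lra|].
  replace (4 * x * (p * p / (1 - p * p) ^ 2) * (1 - p * p) ^ 2) with
    (4 * ((x * p) * p)) by (field; lra).
  assert (x * p * p <= 1 / 10 * (1 / 45)) by (apply Rmult_le_compat; nra). lra.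
Qed.

Lemma exp_INR_mult (n : nat) (y : R) : exp (INR n * y) = exp y ^ n.
Proof.
  induction n as [|n IH].
  - simpl. rewrite Rmult_0_l. apply exp_0.
  - rewrite S_INR. simpl. rewrite <- IH, <- exp_plus. f_equal. ring.
Qed.

(** For [z = q ^ S n <= q], [- ln (1 - z)] is at most [z / (1 - z)], hence at most [z / (1 - q)],
    and a geometric series dominates. The exponent [S n] makes the sum start at the first power. *)
Lemma series_ln_one_minus_pow (q : R) : 0 < q < 1 ->
  exists s, is_series (fun n : nat => ln (Rabs (1 - q ^ S n))) s /\
            - (q / (1 - q) ^ 2) <= s.
Proof.
  intros Hq.
  assert (B : forall n, 0 <= - ln (Rabs (1 - q ^ S n)) <= q / (1 - q) * q ^ n).
  { intros n.
    assert (P : 0 < q ^ n) by (apply pow_lt; lra).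
    assert (L : q ^ n <= 1) by (rewrite <- (pow1 n); apply pow_incr; lra).
    simpl. set (z := q * q ^ n).
    assert (Hz : 0 < z <= q) by (unfold z; split; nra).
    rewrite Rabs_pos_eq by lra.
    pose proof (exp_ineq1_le (ln (1 - z))) as I1.
    pose proof (exp_ineq1_le (- ln (1 - z))) as I2.
    rewrite exp_Ropp in I2. rewrite !exp_ln in I1, I2 by lra.
    split; [lra|]. apply Rle_trans with (/ (1 - z) - 1); [lra|].
    replace (/ (1 - z) - 1) with (z * / (1 - z)) by (field; lra).
    replace (q / (1 - q) * q ^ n) with (z * / (1 - q)) by (unfold z; field; lra).
    apply Rmult_le_compat_l; [lra|]. apply Rinv_le_contravar; lra. }
  assert (G : is_series (fun n => q / (1 - q) * q ^ n) (q / (1 - q) ^ 2)).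
  { replace (q / (1 - q) ^ 2) with (q / (1 - q) * / (1 - q)) by (field; lra).
    apply (is_series_scal (V := R_NormedModule)). apply is_series_geom.
    rewrite Rabs_pos_eq; lra. }
  assert (X : ex_series (fun n => - ln (Rabs (1 - q ^ S n)))).
  { apply (ex_series_le (V := R_CompleteNormedModule)) with (fun n => q / (1 - q) * q ^ n).
    - intros n. change norm with Rabs. simpl Rabs. rewrite Rabs_pos_eq; apply B.
    - eexists. exact G. }
  exists (- Series (fun n => - ln (Rabs (1 - q ^ S n)))). split.
  - apply is_series_ext with (fun n => - - ln (Rabs (1 - q ^ S n))).
    { intros n. apply Ropp_involutive. }
    apply (is_series_opp (V := R_NormedModule) (fun n => - ln (Rabs (1 - q ^ S n)))).
    now apply Series_correct.
  - apply Ropp_le_contravar. rewrite <- (is_series_unique _ _ G).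
    apply Series_le; [exact B|]. eexists. exact G.
Qed.

Lemma ln_le_sub_one (z : R) : 0 < z -> ln z <= z - 1.
Proof. intros H. pose proof (exp_ineq1_le (ln z)). rewrite exp_ln in *; lra. Qed.

(* The trial amplitude is [A = (beta - 1 / (2 beta))^2]: the choice [A = beta^2] only
   matches the target to leading order, and the shift lowers the energy by
   [(ln 2 - 1 / 4) / beta], which absorbs all the remaining errors. *)
Lemma trial_energy_bound (beta s : R) :
  0 < beta -> 9 / 2 <= beta ^ 2 ->
  - (exp (- 2 * beta ^ 2) / (1 - exp (- 2 * beta ^ 2)) ^ 2) <= s ->
  let a := beta - / (2 * beta) in
  2 / 3 * (a ^ 2 * a) - 2 * (1 - ln 2) * a + a * exp (1 - a ^ 2)
    - beta * (a ^ 2 - ln (a ^ 2) - 1)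
  < beta * (ln (4 * beta ^ 2) - 1 - beta ^ 2 / 3 + 4 * s).
Proof.
  intros Hb Hx Hs a.
  destruct (exp_error_bounds _ Hx) as [B1 B2].
  set (eps := exp (- 2 * beta ^ 2) / (1 - exp (- 2 * beta ^ 2)) ^ 2) in *.
  set (i := / beta).
  assert (Pi : 0 < i) by now apply Rinv_0_lt_compat.
  assert (Ei : beta * i = 1) by (unfold i; field; lra).
  assert (Ea : a = beta - i / 2) by (unfold a, i; field; lra).
  assert (Pa : 0 < a) by (rewrite Ea; nra).
  assert (Ea2 : a ^ 2 = beta ^ 2 - 1 + i ^ 2 / 4) by (rewrite Ea; nra).
  assert (Hln : ln a <= ln beta - i ^ 2 / 2).
  { replace a with (beta * (1 - i ^ 2 / 2)).
    - assert (0 < 1 - i ^ 2 / 2) by nra.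
      rewrite ln_mult by assumption. pose proof (ln_le_sub_one (1 - i ^ 2 / 2)). lra.
    - rewrite Ea. transitivity (beta - (beta * i) * i / 2); [field|rewrite Ei; field]. }
  assert (Hln2 : ln (a ^ 2) = 2 * ln a).
  { replace (a ^ 2) with (a * a) by ring. rewrite ln_mult by assumption. ring. }
  assert (Hln4 : ln (4 * beta ^ 2) = 2 * ln 2 + 2 * ln beta).
  { replace (4 * beta ^ 2) with ((2 * beta) * (2 * beta)) by ring.
    rewrite !ln_mult by lra. ring. }
  rewrite Hln2, Hln4.
  assert (Hexp : a * exp (1 - a ^ 2) <= beta * exp (2 - beta ^ 2)).
  { apply Rmult_le_compat; [lra|apply Rlt_le, exp_pos|rewrite Ea; lra|].
    apply exp_nondecreasing. rewrite Ea2. pose proof (pow2_ge_0 i). lra. }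
  assert (Hexp' : a * exp (1 - a ^ 2) <= 4 / 10 * i).
  { apply Rle_trans with (1 := Hexp).
    replace (beta * exp (2 - beta ^ 2)) with ((beta ^ 2 * exp (2 - beta ^ 2)) * i)
      by (unfold i; field; lra). nra. }
  assert (Hs' : - (1 / 100) * i <= 4 * (beta * s)).
  { assert (beta * - eps <= beta * s) by (apply Rmult_le_compat_l; lra).
    replace (4 * beta ^ 2 * eps) with (4 * beta * eps * beta) in B2 by ring.
    assert (4 * beta * eps <= 1 / 100 * i).
    { apply Rmult_le_reg_r with beta; [lra|].
      replace (1 / 100 * i * beta) with (1 / 100) by (unfold i; field; lra). lra. }
    lra. }
  assert (Hln' : 2 * (beta * ln a) <= 2 * (beta * ln beta) - i).
  { assert (beta * ln a <= beta * (ln beta - i ^ 2 / 2)) by (apply Rmult_le_compat_l; lra).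
    replace (beta * (ln beta - i ^ 2 / 2)) with (beta * ln beta - i / 2) in *
      by (unfold i; field; lra). lra. }
  (* The cubic and linear powers of [beta] cancel exactly, leaving [i / 4 - i ^ 3 / 12]. *)
  assert (Hcub : 2 / 3 * (a ^ 2 * a) - beta * a ^ 2 + beta ^ 3 / 3 <= i / 4).
  { replace (2 / 3 * (a ^ 2 * a) - beta * a ^ 2 + beta ^ 3 / 3) with
      (i / 4 - i ^ 3 / 12) by (unfold a, i; field; lra).
    assert (0 < i ^ 3) by (apply pow_lt; lra). lra. }
  (* All terms of order [beta] cancel. The remaining coefficients of [i] total at most
     [1/4 + 4/10 + 1/100 - ln 2], which is negative because [ln 2] exceeds [2/3]. *)
  pose proof ln_2_gt as L2.
  assert (HL : ln 2 * i > 2 / 3 * i) by nra.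
  replace a with (beta - i / 2) at 2 by (symmetry; exact Ea).
  nra.
Qed.

(* Polynomials in [phi'] and [exp phi]: an algebra closed under differentiation when
   [phi'' = c (1 - exp phi)]. *)
Inductive jet : Type :=
| JConst (k : R)
| JSlope
| JExp
| JAdd (f g : jet)
| JMul (f g : jet).

Fixpoint jet_eval (phi p : R -> R) (f : jet) (y : R) : R :=
  match f with
  | JConst k => k
  | JSlope => p y
  | JExp => exp (phi y)
  | JAdd f g => jet_eval phi p f y + jet_eval phi p g y
  | JMul f g => jet_eval phi p f y * jet_eval phi p g y
  end.

Fixpoint jet_deriv (c : R) (f : jet) : jet :=
  match f with
  | JConst _ => JConst 0
  | JSlope => JMul (JConst c) (JAdd (JConst 1) (JMul (JConst (-1)) JExp))
  | JExp => JMul JSlope JExp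
  | JAdd f g => JAdd (jet_deriv c f) (jet_deriv c g)
  | JMul f g => JAdd (JMul (jet_deriv c f) g) (JMul f (jet_deriv c g))
  end.

Lemma jet_is_derive (c : R) (phi p : R -> R) (f : jet) (y : R) :
  (forall z, is_derive phi z (p z)) ->
  (forall z, is_derive p z (c * (1 - exp (phi z)))) ->
  is_derive (jet_eval phi p f) y (jet_eval phi p (jet_deriv c f) y).
Proof.
  intros D1 D2. induction f as [k| | |f IHf g IHg|f IHf g IHg]; simpl.
  - apply (is_derive_const (V := R_NormedModule)).
  - replace (c * (1 + -1 * exp (phi y))) with (c * (1 - exp (phi y))) by ring. apply D2.
  - pose proof (D1 y) as D. auto_derive.
    + repeat apply conj; try easy; eexists; apply D.
    + rewrite_derive D. ring.
  - now apply (is_derive_plus (V := R_NormedModule)).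
  - apply (is_derive_mult (jet_eval phi p f) (jet_eval phi p g)); auto.
    intros; apply Rmult_comm.
Qed.

(** Derivatives of order at least 1 are iterated jets starting from the slope. The function [phi]
    itself is not a jet, hence the index shift and the separate low orders. *)
Lemma ode_derivatives (c : R) (phi p : R -> R) :
  (forall z, is_derive phi z (p z)) ->
  (forall z, is_derive p z (c * (1 - exp (phi z)))) ->
  smooth phi /\ forall y, Derive_n phi 2 y = c * (1 - exp (phi y)).
Proof.
  intros D1 D2.
  assert (H : forall n y, Derive_n phi (S n) y =
                jet_eval phi p (Nat.iter n (jet_deriv c) JSlope) y).
  { induction n as [|n IH]; intros y.
    - apply is_derive_unique, D1.
    - change (Derive (Derive_n phi (S n)) y =
              jet_eval phi p (jet_deriv c (Nat.iter n (jet_deriv c) JSlope)) y).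
      rewrite (Derive_ext _ _ y IH). now apply is_derive_unique, jet_is_derive. }
  split.
  - intros [|[|n]] y.
    + exact I.
    + exists (p y). apply D1.
    + change (ex_derive (Derive_n phi (S n)) y).
      apply ex_derive_ext with (jet_eval phi p (Nat.iter n (jet_deriv c) JSlope)).
      * intros t. symmetry. apply H.
      * eexists. now apply jet_is_derive.
  - intros y. rewrite H. simpl. ring.
Qed.

(** * Rescaling to period [b] and conclusion *)

(** The substitution [y -> u (sqrt (8 * PI) * y)] turns the unit equation into the required one. The
    normalized integral is the mean of [u * (1 + exp u) / 2] over a period, which no rescaling
    changes. *)
Lemma rescaled_orbit (b r : R) : 0 < b -> 0 < r ->
  2 * half_period r = sqrt (8 * PI) * b ->
  exists phi p : R -> R,
    (forall y, is_derive phi y (p y)) /\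
    (forall y, is_derive p y (8 * PI * (1 - exp (phi y)))) /\
    (forall y, phi (y + b) = phi y) /\
    (forall y, phi y <= phi 0) /\
    / (2 * b) * RInt (fun y => phi y * (1 + exp (phi y))) 0 b
      = (action r - half_period r * r ^ 2 / 2) / half_period r.
Proof.
  intros Hb Hr HT. pose proof PI_RGT_0 as Ppi.
  set (k := sqrt (8 * PI)) in *.
  assert (Pk : 0 < k) by (apply sqrt_lt_R0; lra).
  assert (Ek : k * k = 8 * PI) by (apply sqrt_sqrt; lra).
  destruct (periodic_orbit r Hr) as [u [v [Du [Dv [Hper [Hmax HI]]]]]].
  exists (fun y => u (k * y)), (fun y => k * v (k * y)).
  repeat apply conj.
  - intros y. pose proof (Du (k * y)) as D. auto_derive.
    + repeat apply conj; try easy; eexists; apply D.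
    + rewrite_derive D. ring.
  - intros y. pose proof (Dv (k * y)) as D. auto_derive.
    + repeat apply conj; try easy; eexists; apply D.
    + rewrite_derive D. rewrite <- Ek. ring.
  - intros y. replace (k * (y + b)) with (k * y + 2 * half_period r) by (rewrite HT; ring).
    apply Hper.
  - intros y. rewrite Rmult_0_r. apply Hmax.
  - assert (J : is_RInt (fun y => k * (u (k * y + 0) * (1 + exp (u (k * y + 0))) / 2)) 0 b
                  (2 * (action r - half_period r * r ^ 2 / 2))).
    { apply (is_RInt_comp_lin (V := R_NormedModule)
        (fun s => u s * (1 + exp (u s)) / 2) k 0 0 b).
      rewrite Rmult_0_r, !Rplus_0_r, <- HT. exact HI. }
    apply (is_RInt_scal (V := R_NormedModule)) with (k := 2 / k) in J.
    rewrite (is_RInt_unique (V := R_CompleteNormedModule)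
      (fun y => u (k * y) * (1 + exp (u (k * y)))) 0 b
      (2 / k * (2 * (action r - half_period r * r ^ 2 / 2)))).
    + replace (half_period r) with (k * b / 2) by lra. field. lra.
    + refine (is_RInt_ext (V := R_NormedModule) _ _ _ _ _ _ J).
      intros y _. rewrite Rplus_0_r. change scal with Rmult. simpl. field. lra.
Qed.

Theorem mainTheorem4 :
  forall b : R, sqrt (PI / 2) < b ->
  exists phi : R -> R,
    smooth phi /\
    (forall y : R, Derive_n phi 2 y = 8 * PI * (1 - exp (phi y))) /\
    (forall y : R, phi (y + b) = phi y) /\
    (forall y : R, phi y <= phi 0) /\
    let beta := sqrt PI * b in
    exists s : R,
      is_series (fun n : nat => ln (Rabs (1 - exp (- 2 * INR (S n) * beta ^ 2)))) s /\
      / (2 * b) * RInt (fun y => phi y * (1 + exp (phi y))) 0 b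
        + beta ^ 2 / 3 - ln (4 * beta ^ 2) + 1 - 4 * s < 0.
Proof.
  intros b Hb0. pose proof PI_RGT_0 as Ppi.
  assert (Hb : 0 < b) by (apply Rle_lt_trans with (2 := Hb0), sqrt_pos).
  set (beta := sqrt PI * b).
  assert (PsPI : 0 < sqrt PI) by (apply sqrt_lt_R0; lra).
  assert (Pbeta : 0 < beta) by now apply Rmult_lt_0_compat.
  (* The hypothesis on [b] gives [beta ^ 2 > PI ^ 2 / 2], and [PI > 3]. *)
  assert (Hx : 9 / 2 <= beta ^ 2).
  { unfold beta. rewrite Rpow_mult_distr, pow2_sqrt by lra.
    assert (PI / 2 < b ^ 2).
    { rewrite <- (pow2_sqrt (PI / 2)) by lra.
      pose proof (sqrt_pos (PI / 2)). nra. }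
    pose proof PI2_3_2. nra. }
  set (q := exp (- 2 * beta ^ 2)).
  assert (Hq : 0 < q < 1).
  { split; [apply exp_pos|]. unfold q. rewrite <- exp_0. apply exp_increasing. lra. }
  destruct (series_ln_one_minus_pow q Hq) as [s [Hs Bs]].
  set (target := ln (4 * beta ^ 2) - 1 - beta ^ 2 / 3 + 4 * s).
  assert (Hphi : exists phi p : R -> R,
    (forall y, is_derive phi y (p y)) /\
    (forall y, is_derive p y (8 * PI * (1 - exp (phi y)))) /\
    (forall y, phi (y + b) = phi y) /\
    (forall y, phi y <= phi 0) /\
    / (2 * b) * RInt (fun y => phi y * (1 + exp (phi y))) 0 b < target).
  { destruct (Rlt_le_dec 0 target) as [Ht|Ht].
    - (* Close to the bifurcation value of [b] the constant solution is good enough, and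
         the trial energy need not be negative. *)
      exists (fun _ => 0), (fun _ => 0). repeat apply conj.
      + intros y. apply (is_derive_const (V := R_NormedModule)).
      + intros y. replace (8 * PI * (1 - exp 0)) with 0 by (rewrite exp_0; ring).
        apply (is_derive_const (V := R_NormedModule)).
      + reflexivity.
      + intros y. lra.
      + rewrite (RInt_pointwise _ (fun _ => 0)) by (intros; ring).
        rewrite RInt_const. change scal with Rmult. simpl. lra.
    - set (a := beta - / (2 * beta)).
      assert (Hi : / (2 * beta) <= 1 / 4).
      { replace (1 / 4) with (/ 4) by field. apply Rinv_le_contravar; nra. }
      assert (Pa : 1 < a) by (unfold a; nra).
      assert (HA : 1 < a ^ 2) by nra.
      destruct (action_upper_bound (a ^ 2) HA) as [r1 [Hr1 [Er1 Hact]]].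
      rewrite sqrt_pow2 in Hact by lra.
      set (w := sqrt 2) in *.
      assert (Pw : 0 < w) by (apply sqrt_lt_R0; lra).
      (* This is half of the rescaled period [sqrt (8 * PI) * b]. *)
      set (tau := w * beta).
      assert (Ptau : 0 < tau) by now apply Rmult_lt_0_compat.
      assert (Htrial : action r1 - tau * r1 ^ 2 / 2 < tau * target).
      { pose proof (trial_energy_bound beta s Pbeta Hx Bs) as E. fold a target in E.
        cbv zeta in E. apply (Rmult_lt_compat_l w) in E; [|exact Pw].
        replace (tau * r1 ^ 2 / 2) with (tau * (r1 ^ 2 / 2)) by field.
        rewrite Er1. unfold tau. lra. }
      (* As [target <= 0] in this case, the trial value is negative, which keeps the minimizer away
         from the equilibrium [r = 0]. *)
      destruct (half_period_minimizer tau r1) as [r [Hr [Hhp Hle]]]; auto.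
      { apply Rlt_le_trans with (1 := Htrial). nra. }
      destruct (rescaled_orbit b r Hb Hr) as [phi [p [H1 [H2 [H3 [H4 H5]]]]]].
      { rewrite Hhp. unfold tau, beta, w.
        replace (8 * PI) with (2 * 2 * 2 * PI) by ring.
        rewrite !sqrt_mult by lra. rewrite sqrt_sqrt by lra. ring. }
      exists phi, p. repeat apply conj; auto.
      rewrite H5, Hhp. apply Rmult_lt_reg_l with tau; [exact Ptau|].
      replace (tau * ((action r - tau * r ^ 2 / 2) / tau)) with
        (action r - tau * r ^ 2 / 2) by (field; lra). lra. }
  destruct Hphi as [phi [p [H1 [H2 [H3 [H4 H5]]]]]].
  destruct (ode_derivatives (8 * PI) phi p H1 H2) as [HS HD].
  exists phi. repeat apply conj; auto.
  cbv zeta. exists s. split.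
  - apply is_series_ext with (2 := Hs). intros n. do 3 f_equal.
    unfold q. rewrite <- exp_INR_mult. f_equal. ring.
  - unfold target in H5. lra.
Qed.
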